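(* Let $\mathcal P$ be a collection of probability measures on a measurable space $(\Omega,\mathcal F)$, and let $(Z_n)_{n=1}^\infty$ be random variables on $(\Omega,\mathcal F)$ that are independent under every $P\in\mathcal P$. For $B>0$ define $$Z_{n,B}^{\le1}:=(Z_n/B)\cdot\mathbf 1\{|Z_n/B|\le1\}.$$ Suppose that $$\lim_{B\to\infty}\sup_{P\in\mathcal P}\sum_{n=1}^\infty\left|\mathbb E_PZ_{n,B}^{\le1}\right|=0,\quad\lim_{B\to\infty}\sup_{P\in\mathcal P}\sum_{n=1}^\infty\mathrm{Var}_P\,Z_{n,B}^{\le1}=0,\quad\text{and}\quad\lim_{B\to\infty}\sup_{P\in\mathcal P}\sum_{n=1}^\infty P(|Z_n|>B)=0.$$ Then $S_n:=\sum_{k=1}^nZ_k$ is $\mathcal P$-uniformly stochastically nonincreasing, meaning that for every $\delta>0$ there exists $B_\delta>0$ such that for all $n\ge1$, $$\sup_{P\in\mathcal P}P(|S_n|\ge B_\delta)<\delta.$$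
   Context: $\mathbb E_P$ and $\mathrm{Var}_P$ denote expectation and variance under $P$. *)

(* Defs.v *)
From HB Require Import structures.
From mathcomp Require Import all_boot all_order all_algebra.
From mathcomp Require Import finmap.
From mathcomp Require Import all_classical all_reals all_analysis.

Set Implicit Arguments.
Unset Strict Implicit.
Unset Printing Implicit Defensive.

Import Order.TTheory GRing.Theory Num.Theory.
Import numFieldNormedType.Exports.

Local Open Scope classical_set_scope.
Local Open Scope ring_scope.

(* Mutual independence under P of the subfamily (X i) for i in D. *)
Definition independent_RVs (d : measure_display) (T : measurableType d)
    (R : realType) (I : choiceType) (P : probability T R) (D : set I)
    (X : I -> {mfun T >-> R}) : Prop :=
  forall (J : {fset I}) (A : I -> set R),
    [set` J] `<=` D ->
    (forall i, measurable (A i)) ->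
    P (\bigcap_(i in [set` J]) (X i @^-1` A i)) =
      (\prod_(i <- J) P (X i @^-1` A i))%E.

Definition trunc_RV (T : Type) (R : realType) (B : R) (X : T -> R) : T -> R :=
  fun w => (X w / B) * \1_[set w' | `|X w' / B| <= 1] w.

(* The index of S starts at 1; the value S 0 is never used. *)
Definition uniformly_stochastically_nonincreasing (d : measure_display)
    (T : measurableType d) (R : realType) (calP : set (probability T R))
    (S : nat -> T -> R) : Prop :=
  forall delta : R, 0 < delta ->
    exists2 B : R, 0 < B &
      forall n : nat, (1 <= n)%N ->
        (ereal_sup [set P [set w | (B <= `|S n w|)%R] | P in calP]
           < delta%:E)%E.

(* Main.v *)
Require Import Defs.
From HB Require Import structures.
From mathcomp Require Import all_boot all_order all_algebra.
From mathcomp Require Import finmap.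
From mathcomp Require Import all_classical all_reals all_analysis.
From mathcomp Require Import measurable_realfun.
From mathcomp Require Import lra.

(** Fix a truncation level B and let Y_k be Z_k / B, replaced by 0 where
|Z_k| > B.  Outside the union of the events |Z_k| > B, the sum S_n is B times
the sum W of the Y_k, so |S_n| >= B forces |W| >= 1.  If moreover the means of
the Y_k add up to at most 1/2 in absolute value, then |W - E W| >= 1/2, an
event which Chebyshev's inequality bounds by 4 Var W.  The Y_k are bounded and
inherit independence from the Z_k, so Var W is the sum of their variances.
Altogether ([truncated_chebyshev])

  P(|S_n| >= B) <= sum_k P(|Z_k| > B) + 4 sum_k Var Y_k.

Each of the three series has a supremum over calP that tends to 0 as B grows,
and dominates its partial sums since its terms are nonnegative.  Hence one
large B brings the right-hand side below delta / 2, for all P and n at once.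

The additivity of the variance comes from E[XY] = E[X] E[Y] for independent X
and Y ([expectationM_indep]): the joint law of X and Y agrees with the product
of their laws on rectangles, hence everywhere, and Fubini's theorem computes
the integral of x * y against the product law. *)

Set Implicit Arguments.
Unset Strict Implicit.
Unset Printing Implicit Defensive.

Import Order.TTheory GRing.Theory Num.Theory.
Import numFieldNormedType.Exports.

Local Open Scope classical_set_scope.
Local Open Scope ring_scope.

(** * Square-integrable and independent random variables *)

Lemma bounded_Lfun2 (d : measure_display) (T : measurableType d)
    (R : realType) (P : probability T R) (X : T -> R) (c : R) :
  measurable_fun setT X -> (forall w, `|X w| <= c) -> X \in Lfun P 2%:E.
Proof.
move=> mX Xc; rewrite inE; apply/andP; split; rewrite inE//=.
rewrite /finite_norm unlock poweR_lty//.
apply: (@le_lt_trans _ _ (\int[P]_w (cst (c `^ 2)%:E) w)%E); last first.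
  by rewrite integral_cst//= [X in (_ * X)%E]probability_setT mule1 ltry.
apply: ge0_le_integral => //=.
- apply/measurable_EFinP.
  apply: (measurableT_comp (measurable_powR _)) => //.
  exact: measurableT_comp.
- move=> w _; rewrite lee_fin ge0_ler_powR// nnegrE//.
  exact: le_trans (Xc w).
Qed.

(** Rectangles form a generating pi-system, so independence of two random
variables, which only speaks of rectangles, determines their joint law. *)
Lemma joint_distribution_indep (d d1 d2 : measure_display)
    (T : measurableType d) (T1 : measurableType d1) (T2 : measurableType d2)
    (R : realType) (P : probability T R)
    (X : {mfun T >-> T1}) (Y : {mfun T >-> T2}) (XY : {mfun T >-> (T1 * T2)%type}) :
  (forall w, XY w = (X w, Y w)) ->
  (forall A B, measurable A -> measurable B ->
     P (X @^-1` A `&` Y @^-1` B) = (P (X @^-1` A) * P (Y @^-1` B))%E) ->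
  forall C, measurable C ->
    (distribution P X \x distribution P Y)%E C = distribution P XY C.
Proof.
move=> XYE indep; apply: product_measure_unique => A B mA mB.
rewrite /distribution/= /pushforward -indep//.
by congr (P _); apply/seteqP; split=> w /=; rewrite XYE.
Qed.

(** Both sides are integrals of x * y: the left one against the joint law, the
right one, by Fubini's theorem, against the product of the two laws.  These
measures coincide under independence. *)
Lemma expectationM_indep (d : measure_display) (T : measurableType d)
    (R : realType) (P : probability T R) (X Y : {mfun T >-> R}) :
  (X : T -> R) \in Lfun P 1 -> (Y : T -> R) \in Lfun P 1 ->
  ((X : T -> R) * Y) \in Lfun P 1 ->
  (forall A B, measurable A -> measurable B ->
     P (X @^-1` A `&` Y @^-1` B) = (P (X @^-1` A) * P (Y @^-1` B))%E) ->
  ('E_P[(X : T -> R) * Y] = 'E_P[X] * 'E_P[Y])%E.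
Proof.
move=> /Lfun1_integrable iX /Lfun1_integrable iY /Lfun1_integrable iXY indep.
have mXY : measurable_fun setT (fun w => (X w, Y w)).
  exact: measurable_fun_pair.
pose XY : {mfun T >-> (R * R)%type} := mfun_Sub (mem_set mXY).
have jointE := joint_distribution_indep (XY := XY) (fun=> erefl) indep.
pose m12 := (distribution P X \x distribution P Y)%E.
pose f (z : R * R) := (z.1 * z.2)%:E.
have mf : measurable_fun setT f.
  by apply/measurable_EFinP; exact: measurable_funM.
have im12 (g : R * R -> \bar R) :
    (\int[m12]_z g z = \int[distribution P XY]_z g z)%E.
  by apply: eq_measure_integral => C mC _; exact: jointE.
(* |x * y| has the same integral against both laws, and against the joint law
   it is E|XY|. *)
have if12 : m12.-integrable setT f.
  apply/integrableP; split => //.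
  rewrite im12 ge0_integral_distribution//; last exact: measurableT_comp.
  by case/integrableP : iXY.
have iid (Z : {mfun T >-> R}) : P.-integrable setT (EFin \o Z) ->
    (distribution P Z).-integrable setT EFin.
  by move=> iZ; apply: integrable_pushforward.
have Eid (Z : {mfun T >-> R}) : P.-integrable setT (EFin \o Z) ->
    (\int[distribution P Z]_x x%:E = 'E_P[Z])%E.
  by move=> iZ; rewrite integral_distribution// unlock.
have EYfin : 'E_P[Y]%E \is a fin_num.
  by apply: expectation_fin_num; exact/Lfun1_integrable.
have -> : ('E_P[(X : T -> R) * Y] = \int[m12]_z f z)%E.
  by rewrite im12 integral_distribution// unlock.
rewrite -integral12_prod_meas1//.
transitivity (\int[distribution P X]_x (x%:E * 'E_P[Y]))%E.
  apply: eq_integral => x _; rewrite -Eid// -integralZl//; exact: iid.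
by rewrite -(fineK EYfin) integralZr ?Eid//; exact: iid.
Qed.

Lemma covariance_indep (d : measure_display) (T : measurableType d)
    (R : realType) (P : probability T R) (X Y : {mfun T >-> R}) :
  (X : T -> R) \in Lfun P 2%:E -> (Y : T -> R) \in Lfun P 2%:E ->
  (forall A B, measurable A -> measurable B ->
     P (X @^-1` A `&` Y @^-1` B) = (P (X @^-1` A) * P (Y @^-1` B))%E) ->
  covariance P X Y = 0%E.
Proof.
move=> X2 Y2 indep.
have Pfin : P setT \is a fin_num := fin_num_measure P _ measurableT.
have X1 := Lfun_subset12 Pfin X2.
have Y1 := Lfun_subset12 Pfin Y2.
have XY1 := Lfun2_mul_Lfun1 X2 Y2.
rewrite covarianceE// expectationM_indep// subee//.
by rewrite fin_numM ?expectation_fin_num.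
Qed.

(** Bilinearity of the covariance: peeling off one summand leaves a single
cross term, its covariance with the sum of the others, which is 0 term by
term. *)
Lemma variance_sum_uncorrelated (d : measure_display) (T : measurableType d)
    (R : realType) (P : probability T R) (I : eqType) (s : seq I)
    (Y : I -> T -> R) :
  uniq s -> (forall i, i \in s -> Y i \in Lfun P 2%:E) ->
  (forall i j, i \in s -> j \in s -> i != j -> covariance P (Y i) (Y j) = 0%E) ->
  ('V_P[(\sum_(i <- s) Y i)%R] = \sum_(i <- s) 'V_P[Y i])%E.
Proof.
have sumL2 (r : seq I) : (forall i, i \in r -> Y i \in Lfun P 2%:E) ->
    \sum_(i <- r) Y i \in Lfun P 2%:E.
  by move=> Y2; rewrite big_seq; apply: rpred_sum; rewrite ?lee1n.
elim: s => [|i s IHs]; first by rewrite !big_nil variance_cst.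
move=> /= /andP[is_ us] Y2 cov0.
have Yi2 : Y i \in Lfun P 2%:E by rewrite Y2// mem_head.
have Ys2 j : j \in s -> Y j \in Lfun P 2%:E.
  by move=> js; rewrite Y2// inE js orbT.
rewrite !big_cons varianceD ?sumL2//.
rewrite IHs// => [|j k js ks]; last by apply: cov0; rewrite inE ?js ?ks orbT.
suff -> : covariance P (Y i) (\sum_(j <- s) Y j) = 0%E by rewrite mule0 adde0.
have {cov0} : forall j, j \in s -> covariance P (Y i) (Y j) = 0%E.
  move=> j js; apply: cov0; rewrite ?inE ?eqxx ?js ?orbT//.
  by apply: contraNneq is_ => ->.
elim: s Ys2 {is_ us IHs Y2} => [|j s IHs] Ys2 cov0.
  by rewrite big_nil covariance_cst_r.
rewrite big_cons covarianceDr ?sumL2//; last 2 first.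
- by rewrite Ys2// mem_head.
- by move=> k ks; rewrite Ys2// inE ks orbT.
rewrite cov0 ?mem_head// add0e IHs// => k ks; last first.
- by rewrite cov0// inE ks orbT.
- by rewrite Ys2// inE ks orbT.
Qed.

(** Mutual independence, tested on the two-element family {i, j}; the family of
sets equal to A at i and to B elsewhere serves both events at once. *)
Lemma independent_RVs_pair (d : measure_display) (T : measurableType d)
    (R : realType) (I : choiceType) (P : probability T R) (D : set I)
    (Z : I -> {mfun T >-> R}) (i j : I) (A B : set R) :
  independent_RVs P D Z -> D i -> D j -> i != j ->
  measurable A -> measurable B ->
  P (Z i @^-1` A `&` Z j @^-1` B) = (P (Z i @^-1` A) * P (Z j @^-1` B))%E.
Proof.
move=> indep Di Dj ij mA mB.
have ijD : [set` [fset i; j]%fset] `<=` D.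
  by move=> k /=; rewrite !inE => /orP[] /eqP ->.
have mAB k : measurable (if k == i then A else B) by case: ifP.
have := indep _ _ ijD mAB.
rewrite set_fsetU !set_fset1 bigcap_setU !bigcap_set1 eqxx.
rewrite eq_sym (negPf ij) => ->.
rewrite big_fsetU1/= ?inE// big_seq_fset1 eqxx.
by rewrite eq_sym (negPf ij).
Qed.

(** * Truncation *)

(** Truncating is post-composition with a fixed function of a real variable.
This is why truncations of independent variables remain independent. *)
Lemma trunc_RV_comp (T : Type) (R : realType) (B : R) (X : T -> R) :
  trunc_RV B X = trunc_RV B id \o X.
Proof. by apply/funext => w; rewrite /trunc_RV/= !indicE. Qed.

Lemma trunc_RV_le1 (T : Type) (R : realType) (B : R) (X : T -> R) (w : T) :
  `|trunc_RV B X w| <= 1.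
Proof.
rewrite /trunc_RV indicE; have [/set_mem//=|_] := boolP (w \in _).
  by rewrite mulr1.
by rewrite mulr0 normr0.
Qed.

Lemma trunc_RV_id (T : Type) (R : realType) (B : R) (X : T -> R) (w : T) :
  0 < B -> `|X w| <= B -> trunc_RV B X w = X w / B.
Proof.
move=> B0 XB; rewrite /trunc_RV indicE mem_set ?mulr1//=.
by rewrite normrM normfV (gtr0_norm B0) ler_pdivrMr// mul1r.
Qed.

Lemma measurable_trunc_RV (d : measure_display) (T : measurableType d)
    (R : realType) (B : R) (X : T -> R) :
  measurable_fun setT X -> measurable_fun setT (trunc_RV B X).
Proof.
move=> mX.
have mXB : measurable_fun setT (fun w => X w / B) by exact: measurable_funM.
apply: measurable_funM => //; apply: measurable_indic.
have -> : [set w' | `|X w' / B| <= 1] =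
    setT `&` [set w' | `|X w' / B| <= cst 1 w'] by rewrite setTI.
by apply: measurable_fun_le => //; exact: measurableT_comp.
Qed.

(** The quantitative heart: |S_n| >= B either comes from one large Z_k or from a
deviation by at least 1/2 of the truncated sum from its mean.  The factor 4 is
(1/2)^-2 in Chebyshev's inequality; the threshold 1/2 is what the bound on
the means leaves of 1 = B / B. *)
Lemma truncated_chebyshev (d : measure_display) (T : measurableType d)
    (R : realType) (P : probability T R) (Z : nat -> {mfun T >-> R})
    (B : R) (n : nat) :
  independent_RVs P [set n : nat | (1 <= n)%N] Z -> 0 < B ->
  (\sum_(1 <= k < n.+1) `|'E_P[trunc_RV B (Z k)]| <= (2^-1)%:E)%E ->
  (P [set w | (B <= `|\sum_(1 <= k < n.+1) Z k w|)%R] <=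
   \sum_(1 <= k < n.+1) P [set w | (B < `|Z k w|)%R] +
   4%:E * \sum_(1 <= k < n.+1) 'V_P[trunc_RV B (Z k)])%E.
Proof.
move=> indep B0 meanle.
have mY k : measurable_fun setT (trunc_RV B (Z k)) by exact: measurable_trunc_RV.
have Y2 k : trunc_RV B (Z k) \in Lfun P 2%:E.
  by apply: (@bounded_Lfun2 _ _ _ _ _ 1) => // w; exact: trunc_RV_le1.
have Y1 k : trunc_RV B (Z k) \in Lfun P 1.
  exact: (Lfun_subset12 (fin_num_measure P _ measurableT)).
pose W : T -> R := \sum_(1 <= k < n.+1) trunc_RV B (Z k).
have WE w : W w = \sum_(1 <= k < n.+1) trunc_RV B (Z k) w by rewrite /W fct_sumE.
have mW : measurable_fun setT W.
  by rewrite /W fct_sumE; exact: measurable_sum.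
have VW : ('V_P[W] = \sum_(1 <= k < n.+1) 'V_P[trunc_RV B (Z k)])%E.
  apply: variance_sum_uncorrelated => [|//|i j]; first exact: iota_uniq.
  rewrite !mem_index_iota => /andP[i1 _] /andP[j1 _] ij.
  apply: (@covariance_indep _ _ _ _ (mfun_Sub (mem_set (mY i)))
                                    (mfun_Sub (mem_set (mY j)))) => //= A C mA mC.
  have mg : measurable_fun setT (trunc_RV B (@id R)) by exact: measurable_trunc_RV.
  rewrite (trunc_RV_comp B (Z i)) (trunc_RV_comp B (Z j)).
  apply: (independent_RVs_pair (A := trunc_RV B id @^-1` A)
    (B := trunc_RV B id @^-1` C) indep) => //;
    by rewrite -[X in measurable X]setTI; apply: mg.
have EW : (`|'E_P[W]| <= (2^-1)%:E)%E.
  apply: le_trans meanle.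
  rewrite (_ : 'E_P[W] = \sum_(1 <= k < n.+1) 'E_P[trunc_RV B (Z k)])%E.
    exact: lee_abs_sum.
  rewrite /W -(big_map (fun k => trunc_RV B (Z k)) xpredT id) expectation_sum.
    by rewrite big_map.
  by move=> f /mapP[k _ ->].
have EWfin : ('E_P[W] \is a fin_num)%E.
  rewrite -abse_fin_num fin_numElt (le_lt_trans EW) ?ltry//.
  by rewrite (lt_le_trans _ (abse_ge0 _)).
pose C := [set w | (2^-1 <= `|W w - fine 'E_P[W]|)%R].
pose A k := [set w | (B < `|Z k w|)%R].
have mA k : measurable (A k).
  have mb : measurable_fun setT (fun w => B < `|Z k w|).
    by apply: measurable_fun_ltr => //; exact: measurableT_comp.
  by rewrite -[A k]setTI; exact: (mb measurableT [set true]).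
have mC : measurable C.
  rewrite -[C]setTI; apply: measurable_fun_le => //.
  by apply: measurableT_comp => //; exact: measurable_funB.
have incl : [set w | (B <= `|\sum_(1 <= k < n.+1) Z k w|)%R] `<=`
    \big[setU/set0]_(k < n) A k.+1 `|` C.
  move=> w /= BS; have [Aw|nAw] := pselect ((\big[setU/set0]_(k < n) A k.+1) w).
    by left.
  (* No Z_k exceeds B, so no truncation takes effect. *)
  right; rewrite /C/=.
  have SW : W w = (\sum_(1 <= k < n.+1) Z k w) / B.
    rewrite WE mulr_suml; apply: eq_big_nat => k /andP[k1 kn].
    apply: trunc_RV_id => //; rewrite leNgt; apply/negP => BZ; apply: nAw.
    rewrite -(bigcup_mkord n (fun k => A k.+1)); exists k.-1 => /=.
      by rewrite -ltnS prednK.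
    by rewrite prednK.
  have W1 : 1 <= `|W w|.
    by rewrite SW normrM normfV (gtr0_norm B0) ler_pdivlMr// mul1r.
  have : `|fine 'E_P[W]| <= 2^-1.
    by rewrite -lee_fin -fine_abse// fineK ?abse_fin_num.
  have := lerB_dist (W w) (fine 'E_P[W]%E).
  lra.
have mS : measurable [set w | (B <= `|\sum_(1 <= k < n.+1) Z k w|)%R].
  rewrite -[X in measurable X]setTI; apply: measurable_fun_le => //.
  by apply: measurableT_comp => //; exact: measurable_sum.
have mUA : measurable (\big[setU/set0]_(k < n) A k.+1).
  exact: bigsetU_measurable.
apply: le_trans (le_measure _ _ _ incl) _; rewrite ?inE//.
  exact: measurableU.
apply: le_trans (measureU2 P mUA mC) _.
apply: leeD.
  rewrite big_add1/= big_mkord.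
  exact: (Boole_inequality P (A := fun k => A k.+1)).
rewrite -VW.
have := @chebyshev _ _ _ P (mfun_Sub (mem_set mW)) 2^-1.
rewrite invr_gt0 ltr0n => /(_ isT) /le_trans; apply.
by rewrite exprVn invrK -natrX.
Qed.

(** * Uniformity over the family of measures *)

(** Convergence of the suprema to 0 turns into one threshold for B, valid for
all members of the family simultaneously. *)
Lemma cvg_ereal_sup_lt (R : realType) (I : Type) (D : set I)
    (f : R -> I -> \bar R) (e : R) :
  ereal_sup [set f B i | i in D] @[B --> +oo] --> 0%E -> 0 < e ->
  \forall B \near +oo, forall i, D i -> (f B i < e%:E)%E.
Proof.
move=> fcvg e0.
have : \forall B \near +oo, (ereal_sup [set f B i | i in D] < e%:E)%E.
  by apply: (fcvg [set y | y < e%:E]%E); exact: open_ereal_lt'.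
apply: filterS => B supB i Di; apply: le_lt_trans supB.
by apply: ereal_sup_ubound; exists i.
Qed.

Theorem theorem5 (R : realType) (d : measure_display) (T : measurableType d)
    (calP : set (probability T R)) (Z : nat -> {mfun T >-> R})
    (Zindep : forall P : probability T R, calP P ->
       independent_RVs P [set n : nat | (1 <= n)%N] Z)
    (Zmean :
       ereal_sup [set (\sum_(1 <= n <oo) `| 'E_P[trunc_RV B (Z n)] |)%E
                 | P in calP] @[B --> +oo] --> 0%E)
    (Zvar :
       ereal_sup [set (\sum_(1 <= n <oo) 'V_P[trunc_RV B (Z n)])%E
                 | P in calP] @[B --> +oo] --> 0%E)
    (Ztail :
       ereal_sup [set (\sum_(1 <= n <oo) P [set w | ((B : R) < `|Z n w|)%R])%E
                 | P in calP] @[B --> +oo] --> 0%E) :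
  uniformly_stochastically_nonincreasing calP
    (fun n w => \sum_(1 <= k < n.+1) Z k w).
Proof.
move=> delta delta0.
have half0 : 0 < 2^-1 :> R by rewrite invr_gt0.
have quarter0 : 0 < delta / 4 by rewrite divr_gt0.
have sixteenth0 : 0 < delta / 16 by rewrite divr_gt0.
have mean_near := cvg_ereal_sup_lt Zmean half0.
have var_near := cvg_ereal_sup_lt Zvar sixteenth0.
have tail_near := cvg_ereal_sup_lt Ztail quarter0.
have gt0_near : \forall B \near (+oo : set_system R), 0 < B.
  by apply: nbhs_pinfty_gt; rewrite num_real.
have [B [[[meanB varB] tailB] B0]] := filter_ex
  (filterI (filterI (filterI mean_near var_near) tail_near) gt0_near).
exists B => // n _.
apply: (@le_lt_trans _ _ (delta / 2)%:E); last by rewrite lte_fin; lra.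
apply: ge_ereal_sup => _ [P calPP <-].
apply: le_trans (truncated_chebyshev (Zindep P calPP) B0 _) _.
  apply: le_trans (ltW (meanB P calPP)).
  by apply: nneseries_lim_ge => k _ _; exact: abse_ge0.
(* delta / 4 for the tails, and four times delta / 16 for the variances. *)
have -> : delta / 2 = delta / 4 + 4 * (delta / 16) by lra.
rewrite (EFinD (delta / 4)) (EFinM 4); apply: leeD.
  apply: le_trans (ltW (tailB P calPP)).
  by apply: nneseries_lim_ge => k _ _; exact: measure_ge0.
apply: lee_wpmul2l; first by rewrite lee_fin.
apply: le_trans (ltW (varB P calPP)).
by apply: nneseries_lim_ge => k _ _; exact: variance_ge0.
Qed.
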